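(* Let $(\mathfrak{L}^{n+1},\mathfrak{g},\Psi)$ be an electrostatic spacetime and let $\Sigma^{n-1}\hookrightarrow M^n$ be a smooth, totally umbilic hypersurface of a canonical time slice $M^n(t)$. Assume that $N$, $\Psi$, and $|d\Psi|$ are constant on $\Sigma^{n-1}$ and $dN$ is non-vanishing on $\Sigma^{n-1}$. Assume furthermore that $NH=(n-1)\nu(N)$ is satisfied on $\Sigma^{n-1}$. Then $\mathbb{R}\times\Sigma^{n-1}\hookrightarrow\mathfrak{L}^{n+1}$ is a non-degenerate photon sphere in $(\mathfrak{L}^{n+1},\mathfrak{g},\Psi)$.
   Context: All manifolds and tensor fields are smooth, submanifolds embedded; $n\ge3$. Electrostatic spacetime: $\mathfrak{L}^{n+1}=\mathbb{R}\times M^n$, $\mathfrak{g}=-N^2dt^2+g$ with $(M^n,g)$ Riemannian, $N\colon M^n\to(0,\infty)$, together with a time-independent function $\Psi\colon M^n\to\mathbb{R}$; no field equations are assumed. $\nu$ is a unit normal to $\Sigma^{n-1}$ in $(M^n,g)$ and $H$ its mean curvature, the trace of $h(X,Y)=-g(\nabla_XY,\nu)$. Photon surface: a timelike totally umbilic hypersurface (equivalently, null geodesics initially tangent remain tangent). Photon sphere: a photon surface $P^n=\mathbb{R}\times\Sigma^{n-1}$ along which $N$, $\Psi$, and $|d\Psi|_{\mathfrak{g}}$ are constant. Non-degenerate: $dN\neq0$ at every point of $P^n$. *)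

(* Defs.v *)
(* Smooth manifolds, semi-Riemannian metrics and the geometry of hypersurfaces,
   in coordinates, over an arbitrary [R : realType].

   Conventions: tangent vectors in a chart are row vectors, so the differential
   of a map acts by right multiplication with the matrix [jac] whose rows are
   indexed by the source coordinates.  All pointwise quantities take the charts
   in which they are computed as arguments; statements quantify over every
   chart containing the point. *)
From HB Require Import structures.
From mathcomp Require Import all_boot all_order all_algebra.
From mathcomp Require Import all_classical all_reals all_analysis.

Set Implicit Arguments.
Unset Strict Implicit.
Unset Printing Implicit Defensive.

Import Order.TTheory GRing.Theory Num.Theory.
Import numFieldNormedType.Exports.
Local Open Scope classical_set_scope.
Local Open Scope ring_scope.

Section Calculus.
Variable R : realType.

Definition partial n (j : 'I_n) (f : 'rV[R]_n -> R) (x : 'rV[R]_n) : R :=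
  'D_(delta_mx 0 j : 'rV[R]_n) f x.

Fixpoint Ck (k : nat) n (U : set 'rV[R]_n) (f : 'rV[R]_n -> R) : Prop :=
  (forall x, U x -> {for x, continuous f}) /\
  (if k is k'.+1 then
     forall j : 'I_n,
       (forall x, U x -> derivable f x (delta_mx 0 j : 'rV[R]_n)) /\
       Ck k' U (partial j f)
   else True).

Definition smooth_fct n (U : set 'rV[R]_n) (f : 'rV[R]_n -> R) : Prop :=
  forall k, Ck k U f.

Definition smooth_mx n p q (U : set 'rV[R]_n) (F : 'rV[R]_n -> 'M[R]_(p, q)) :
    Prop :=
  forall i j, smooth_fct U (fun x => F x i j).

(* For the smooth maps considered here this is the library's ['J F x]; the
   partial derivatives are used directly because ['J] is only meaningful for
   maps already known to be Frechet differentiable. *)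
Definition jac n m (F : 'rV[R]_n -> 'rV[R]_m) (x : 'rV[R]_n) : 'M[R]_(n, m) :=
  \matrix_(i, j) partial i (fun y => F y 0 j) x.

Lemma CkC k n (U : set 'rV[R]_n) f x : Ck k U f -> U x -> {for x, continuous f}.
Proof. by case: k => [|k] [cf _]; apply: cf. Qed.

Lemma Ck_sub k n (U V : set 'rV[R]_n) f : U `<=` V -> Ck k V f -> Ck k U f.
Proof.
elim: k f => [|k IH] f sUV [cf df]; first by split=> // x /sUV; exact: cf.
split=> [x /sUV|j]; first exact: cf.
by have [d1 d2] := df j; split=> [x /sUV|]; [exact: d1|exact: IH].
Qed.

Lemma CkS k n (U : set 'rV[R]_n) f : Ck k.+1 U f -> Ck k U f.
Proof.
elim: k f => [|k IH] f [cf df]; first by split.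
by split=> // j; have [d1 d2] := df j; split=> //; apply: IH.
Qed.

Lemma Ck_ext k n (U : set 'rV[R]_n) f g : open U ->
  (forall x, U x -> f x = g x) -> Ck k U f -> Ck k U g.
Proof.
move=> oU.
have nearU (P : set 'rV[R]_n) x : U x -> (forall y, U y -> P y) -> nbhs x P.
  by move=> Ux UP; exact: filterS UP (open_nbhs_nbhs (conj oU Ux)).
have cont (f' g' : 'rV[R]_n -> R) x : (forall x, U x -> f' x = g' x) -> U x ->
    {for x, continuous f'} -> {for x, continuous g'}.
  move=> fg Ux cf; rewrite /prop_for /continuous_at -(fg _ Ux).
  have nfg : \forall y \near x, f' y = g' y by exact: (nearU _ _ Ux fg).
  exact: (cvg_trans (near_eq_cvg nfg) cf).
elim: k f g => [|k IH] f g fg [cf df].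
  by split=> // x Ux; exact: cont fg Ux (cf x Ux).
split=> [x Ux|j]; first exact: cont fg Ux (cf x Ux).
have [d1 d2] := df j; split=> [x Ux|].
  by apply: near_eq_derivable (d1 x Ux); exact (nearU _ _ Ux fg).
by apply: IH d2 => x Ux; apply: near_eq_derive; exact (nearU _ _ Ux fg).
Qed.

Lemma Ck_cst k n (U : set 'rV[R]_n) (c : R) : Ck k U (fun=> c).
Proof.
elim: k c => [|k IH] c; first by split=> // x _; exact: cst_continuous.
split=> [x _|j]; first exact: cst_continuous.
split=> [x _|]; first exact: derivable_cst.
suff -> : partial j (fun=> c) = fun=> 0 by exact: IH.
by apply/funext => x; exact: derive_cst.
Qed.

Lemma CkD k n (U : set 'rV[R]_n) f g : open U ->
  Ck k U f -> Ck k U g -> Ck k U (fun x => f x + g x).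
Proof.
move=> oU; elim: k f g => [|k IH] f g [cf df] [cg dg].
  by split=> // x Ux; apply: continuousD; [exact: cf|exact: cg].
split=> [x Ux|j]; first by apply: continuousD; [exact: cf|exact: cg].
have [df1 df2] := df j; have [dg1 dg2] := dg j.
split=> [x Ux|]; first by apply: derivableD; [exact: df1|exact: dg1].
apply: Ck_ext (IH _ _ df2 dg2) => // x Ux.
by rewrite /partial deriveD //; [exact: df1|exact: dg1].
Qed.

Lemma CkM k n (U : set 'rV[R]_n) f g : open U ->
  Ck k U f -> Ck k U g -> Ck k U (fun x => f x * g x).
Proof.
move=> oU; elim: k f g => [|k IH] f g Cf Cg.
  by split=> // x Ux; apply: continuousM; [exact: CkC Cf _|exact: CkC Cg _].
split=> [x Ux|j]; first by apply: continuousM; [exact: CkC Cf _|exact: CkC Cg _].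
have [df1 df2] := Cf.2 j; have [dg1 dg2] := Cg.2 j.
split=> [x Ux|]; first by apply: derivableM; [exact: df1|exact: dg1].
apply: Ck_ext (CkD oU (IH _ _ (CkS Cf) dg2) (IH _ _ (CkS Cg) df2)) => // x Ux.
by rewrite /partial deriveM //; [exact: df1|exact: dg1].
Qed.

(* Points of R x R^n are written as row vectors of length 1 + n. *)
Section Lift.
Variable n : nat.
Implicit Types (f : 'rV[R]_n -> R) (x : 'rV[R]_(1 + n)).

Lemma mx_continuous (T : topologicalType) p q (F : T -> 'M[R]_(p, q)) t :
  (forall i j, {for t, continuous (fun s => F s i j)}) -> {for t, continuous F}.
Proof.
move=> cF A [P nP sPA]; rewrite nbhs_filterE /=.
have : \forall s \near t, forall i j, P i j (F s i j).
  apply: filter_forall => i; apply: filter_forall => j; exact: cF (nP i j).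
by apply: filterS => s Ps; apply: sPA.
Qed.

Lemma rsubmx_continuous : continuous (@rsubmx R 1 1 n).
Proof.
move=> x; apply: mx_continuous => i j.
under [X in {for _, continuous X}]funext do rewrite mxE.
exact: coord_continuous.
Qed.

Lemma rsubmx_delta0 : rsubmx (delta_mx 0 (lshift n 0) : 'rV[R]_(1 + n)) = 0.
Proof. by apply/rowP => k; rewrite !mxE eq_rlshift andbF. Qed.

Lemma rsubmx_deltar j :
  rsubmx (delta_mx 0 (rshift 1 j) : 'rV[R]_(1 + n)) = delta_mx 0 j.
Proof. by apply/rowP => k; rewrite !mxE eq_rshift. Qed.

Lemma quotient_lift f x (v : 'rV[R]_(1 + n)) :
  (fun h : R => h^-1 *: (((fun y => f (rsubmx y)) \o shift x) (h *: v) -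
                         f (rsubmx x))) =
  (fun h : R => h^-1 *: ((f \o shift (rsubmx x)) (h *: rsubmx v) -
                         f (rsubmx x))).
Proof. by apply/funext => h /=; rewrite linearP. Qed.

Lemma derivable_dir0 f (x : 'rV[R]_n) : derivable f x 0.
Proof.
rewrite /derivable.
rewrite [X in X @ _](_ : _ = cst 0); first exact: is_cvg_cst.
by apply/funext => h /=; rewrite scaler0 add0r subrr scaler0.
Qed.

Lemma derive_lift f x (v : 'rV[R]_(1 + n)) :
  'D_v (fun y => f (rsubmx y)) x = 'D_(rsubmx v) f (rsubmx x).
Proof. by rewrite /derive quotient_lift. Qed.

Lemma derivable_lift f x (v : 'rV[R]_(1 + n)) :
  derivable f (rsubmx x) (rsubmx v) -> derivable (fun y => f (rsubmx y)) x v.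
Proof. by rewrite /derivable quotient_lift. Qed.

Lemma partial_lift0 f :
  partial (lshift n 0) (fun x : 'rV[R]_(1 + n) => f (rsubmx x)) = fun=> 0.
Proof.
by apply/funext => x; rewrite /partial derive_lift rsubmx_delta0 derive0.
Qed.

Lemma partial_liftr f j :
  partial (rshift 1 j) (fun x : 'rV[R]_(1 + n) => f (rsubmx x)) =
  fun x => partial j f (rsubmx x).
Proof.
by apply/funext => x; rewrite /partial derive_lift rsubmx_deltar.
Qed.

Lemma Ck_lift k (U : set 'rV[R]_n) f : Ck k U f ->
  Ck k [set x : 'rV[R]_(1 + n) | U (rsubmx x)] (fun x => f (rsubmx x)).
Proof.
have cl (f' : 'rV[R]_n -> R) (x : 'rV[R]_(1 + n)) :
    {for rsubmx x, continuous f'} ->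
    {for x, continuous (fun x : 'rV[R]_(1 + n) => f' (rsubmx x))}.
  by move=> cf; apply: (continuous_comp (@rsubmx_continuous x)).
elim: k f => [|k IH] f [cf df].
  by split=> // x Ux; apply: cl; exact: cf.
split=> [x Ux|j]; first by apply: cl; exact: cf.
case: (split_ordP j) => {}j ->.
  rewrite (ord1 j); split=> [x _|].
    by apply: derivable_lift; rewrite rsubmx_delta0; exact: derivable_dir0.
  by rewrite partial_lift0; exact: Ck_cst.
split=> [x Ux|]; last first.
  by rewrite partial_liftr; apply: IH; exact: (df j).2.
by apply: derivable_lift; rewrite rsubmx_deltar; exact: (df j).1.
Qed.

Lemma quotient_time_cvg (x v : 'rV[R]_(1 + n)) :
  h^-1 *: (((fun y : 'rV[R]_(1 + n) => lsubmx y 0 0) \o shift x) (h *: v) -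
           lsubmx x 0 0) @[h --> 0^'] --> lsubmx v 0 0.
Proof.
apply: (@cvg_trans _ (cst (lsubmx v 0 0) @ (0 : R)^')); last exact: cvg_cst.
apply: near_eq_cvg; near=> h; rewrite /= !mxE addrK.
rewrite -[RHS]/(_ * (_ * _)) mulrA mulVf ?mul1r //.
by near: h; exact: nbhs_dnbhs_neq.
Unshelve. all: by end_near. Qed.

Lemma is_derive_time (x v : 'rV[R]_(1 + n)) :
  is_derive x v (fun y : 'rV[R]_(1 + n) => lsubmx y 0 0) (lsubmx v 0 0).
Proof.
apply: DeriveDef.
  apply/cvg_ex; exists (lsubmx v 0 0).
  exact: quotient_time_cvg.
apply/cvg_lim => //; exact: quotient_time_cvg.
Qed.

Lemma partial_time j :
  partial j (fun x : 'rV[R]_(1 + n) => lsubmx x 0 0) =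
  fun=> (j == lshift n 0)%:R.
Proof.
apply/funext => x; rewrite /partial.
by rewrite (@derive_val _ _ _ _ _ _ _ (is_derive_time x _)) !mxE eqxx eq_sym.
Qed.

Lemma time_continuous : continuous (fun x : 'rV[R]_(1 + n) => lsubmx x 0 0).
Proof.
under [X in continuous X]funext do rewrite mxE.
exact: coord_continuous.
Qed.

Lemma Ck_time k (U : set 'rV[R]_(1 + n)) : Ck k U (fun x => lsubmx x 0 0).
Proof.
case: k => [|k]; first by split=> // x _; exact: time_continuous.
split=> [x _|j]; first exact: time_continuous.
split=> [x _|]; first by case: (is_derive_time x (delta_mx 0 j)).
by rewrite partial_time; exact: Ck_cst.
Qed.

Lemma jac_lift m (F : 'rV[R]_n -> 'rV[R]_m) x :
  jac (fun x : 'rV[R]_(1 + n) =>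
         row_mx (lsubmx x) (F (rsubmx x)) : 'rV[R]_(1 + m)) x =
  block_mx 1%:M 0 0 (jac F (rsubmx x)).
Proof.
have eL j : (fun y : 'rV[R]_(1 + n) =>
    (row_mx (lsubmx y) (F (rsubmx y)) : 'rV[R]_(1 + m)) 0 (lshift m j)) =
    fun y => lsubmx y 0 0.
  by apply/funext => y; rewrite row_mxEl (ord1 j).
have eR j : (fun y : 'rV[R]_(1 + n) =>
    (row_mx (lsubmx y) (F (rsubmx y)) : 'rV[R]_(1 + m)) 0 (rshift 1 j)) =
    fun y => F (rsubmx y) 0 j.
  by apply/funext => y; rewrite row_mxEr.
apply/matrixP => i j; rewrite mxE.
case: (split_ordP i) => {}i ->; case: (split_ordP j) => {}j ->.
- by rewrite eL partial_time block_mxEul mxE !ord1 !eqxx.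
- by rewrite eR (ord1 i) (partial_lift0 (fun y => F y 0 j)) block_mxEur mxE.
- by rewrite eL partial_time block_mxEdl mxE eq_rlshift.
- by rewrite eR (partial_liftr (fun y => F y 0 j)) block_mxEdr mxE.
Qed.

End Lift.
End Calculus.

(* A smooth manifold of dimension n, given by an indexed smooth atlas that need
   not be maximal.  [chart_inv i] is only meaningful on the image of chart i. *)
Record manifold (R : realType) (n : nat) := Manifold {
  mcarrier :> topologicalType;
  chart_index : Type;
  chart_dom : chart_index -> set mcarrier;
  chart : chart_index -> mcarrier -> 'rV[R]_n;
  chart_inv : chart_index -> 'rV[R]_n -> mcarrier;
  open_chart_dom : forall i, open (chart_dom i);
  open_chart_image : forall i, open (chart i @` chart_dom i);
  chart_cover : forall p, exists i, chart_dom i p;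
  chartK : forall i p, chart_dom i p -> chart_inv i (chart i p) = p;
  chart_continuous : forall i p, chart_dom i p -> {for p, continuous (chart i)};
  chart_inv_continuous : forall i p, chart_dom i p ->
    {for chart i p, continuous (chart_inv i)};
  transition_smooth : forall i j,
    smooth_mx (chart i @` (chart_dom i `&` chart_dom j))
              (chart j \o chart_inv i);
  manifold_hausdorff : hausdorff_space mcarrier;
  manifold_second_countable : @second_countable mcarrier }.

Arguments chart_index {R n} m.
Arguments chart_dom {R n m} i _.
Arguments chart {R n m} i _.
Arguments chart_inv {R n m} i _.

Section Geometry.
Variable R : realType.

Definition transition n (M : manifold R n) (i j : chart_index M) :
    'rV[R]_n -> 'rV[R]_n :=
  chart j \o chart_inv i.

Definition smooth_scalar n (M : manifold R n) (f : M -> R) : Prop :=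
  forall i : chart_index M,
    smooth_fct (chart i @` chart_dom i) (f \o chart_inv i).

(* Components of the differential of f at p in the chart i. *)
Definition differential n (M : manifold R n) (f : M -> R) (i : chart_index M)
    (p : M) : 'rV[R]_n :=
  \row_k partial k (f \o chart_inv i) (chart i p).

Definition directional_derivative n (M : manifold R n) (f : M -> R)
    (i : chart_index M) (p : M) (v : 'rV[R]_n) : R :=
  (v *m (differential f i p)^T) 0 0.

(* A semi-Riemannian metric, given by its Gram matrices in the charts. *)
Record metric n (M : manifold R n) := Metric {
  gram :> chart_index M -> M -> 'M[R]_n;
  gram_smooth : forall i,
    smooth_mx (chart i @` chart_dom i) (gram i \o chart_inv i);
  gram_sym : forall i p, chart_dom i p -> (gram i p)^T = gram i p;
  gram_unit : forall i p, chart_dom i p -> gram i p \in unitmx;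
  gram_transition : forall i j p, chart_dom i p -> chart_dom j p ->
    gram i p = jac (transition i j) (chart i p) *m gram j p *m
               (jac (transition i j) (chart i p))^T }.

Definition inner n (M : manifold R n) (g : metric M) (i : chart_index M) (p : M)
    (v w : 'rV[R]_n) : R :=
  (v *m g i p *m w^T) 0 0.

Definition riemannian n (M : manifold R n) (g : metric M) : Prop :=
  forall i p, chart_dom i p -> forall v, v != 0 -> 0 < inner g i p v v.

(* |df|_g; the absolute value only matters for indefinite g. *)
Definition differential_norm n (M : manifold R n) (g : metric M) (f : M -> R)
    (i : chart_index M) (p : M) : R :=
  let df := differential f i p in
  Num.sqrt `|(df *m invmx (g i p) *m df^T) 0 0|.

Definition partial_gram n (M : manifold R n) (g : metric M) (i : chart_index M)
    (p : M) (a b c : 'I_n) : R :=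
  partial a (fun x => g i (chart_inv i x) b c) (chart i p).

(* The Christoffel symbol Gamma^k_{ab} of the Levi-Civita connection. *)
Definition christoffel n (M : manifold R n) (g : metric M) (i : chart_index M)
    (p : M) (k a b : 'I_n) : R :=
  2^-1 * \sum_l invmx (g i p) k l *
    (partial_gram g i p a b l + partial_gram g i p b a l
     - partial_gram g i p l a b).

(* A symmetric bilinear form of signature (-,+,...,+): the space is the
   orthogonal sum of a negative line and a positive definite hyperplane. *)
Definition lorentzian_form n (A : 'M[R]_n) : Prop :=
  exists2 v : 'rV[R]_n, (v *m A *m v^T) 0 0 < 0 &
    forall w : 'rV[R]_n, w != 0 -> (v *m A *m w^T) 0 0 = 0 ->
      0 < (w *m A *m w^T) 0 0.

Section Maps.
Variables (k n : nat) (S : manifold R k) (M : manifold R n) (f : S -> M).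
Implicit Types (a : chart_index S) (i : chart_index M) (p : S).

Definition local_expr a i : 'rV[R]_k -> 'rV[R]_n := chart i \o f \o chart_inv a.

Definition smooth_map : Prop :=
  continuous f /\
  forall a i, smooth_mx (chart a @` (chart_dom a `&` f @^-1` chart_dom i))
                        (local_expr a i).

(* The matrix of the differential of f at p; row b is the image of the b-th
   coordinate vector of the chart a. *)
Definition pushforward a i p : 'M[R]_(k, n) :=
  jac (local_expr a i) (chart a p).

Definition immersion : Prop :=
  smooth_map /\
  forall a i p, chart_dom a p -> chart_dom i (f p) ->
    row_free (pushforward a i p).

Definition smooth_embedding : Prop :=
  [/\ immersion, injective f &
      forall U : set S, open U -> exists2 V : set M, open V & U = f @^-1` V].

Definition hypersurface : Prop := n = k.+1 /\ smooth_embedding.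

Variable g : metric M.

Definition induced_form a i p : 'M[R]_k :=
  pushforward a i p *m g i (f p) *m (pushforward a i p)^T.

Definition timelike : Prop :=
  forall a i p, chart_dom a p -> chart_dom i (f p) ->
    lorentzian_form (induced_form a i p).

Definition unit_normal a i p (nu : 'rV[R]_n) : Prop :=
  (forall X : 'rV[R]_k, inner g i (f p) (X *m pushforward a i p) nu = 0) /\
  `|inner g i (f p) nu nu| = 1.

(* nu i p gives the components in the chart i of a vector at f p. *)
Definition vector_field_along (nu : chart_index M -> S -> 'rV[R]_n) : Prop :=
  (forall a i, smooth_mx (chart a @` (chart_dom a `&` f @^-1` chart_dom i))
                         (nu i \o chart_inv a)) /\
  (forall i j p, chart_dom i (f p) -> chart_dom j (f p) ->
    nu j p = nu i p *m jac (transition i j) (chart i (f p))).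

Definition unit_normal_field (nu : chart_index M -> S -> 'rV[R]_n) : Prop :=
  vector_field_along nu /\
  forall a i p, chart_dom a p -> chart_dom i (f p) -> unit_normal a i p (nu i p).

(* nabla_X V at p, for X tangent to S and V a vector field along f, both
   expressed in the charts a and i. *)
Definition covariant_derivative a i p (X : 'rV[R]_k)
    (V : 'rV[R]_k -> 'rV[R]_n) : 'rV[R]_n :=
  \row_c ('D_X (fun u => V u 0 c) (chart a p) +
          \sum_d \sum_e christoffel g i (f p) c d e *
            (X *m pushforward a i p) 0 d * V (chart a p) 0 e).

(* h(X, Y) = - g(nabla_X Y, nu) on the coordinate fields of the chart a. *)
Definition second_fundamental_form a i p (nu : 'rV[R]_n) : 'M[R]_k :=
  \matrix_(b, c) - inner g i (f p)
    (covariant_derivative a i p (delta_mx 0 b)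
       (fun u => row c (jac (local_expr a i) u))) nu.

Definition mean_curvature a i p (nu : 'rV[R]_n) : R :=
  \tr (invmx (induced_form a i p) *m second_fundamental_form a i p nu).

(* The condition is insensitive to the sign of the unit normal. *)
Definition totally_umbilic : Prop :=
  forall a i p, chart_dom a p -> chart_dom i (f p) ->
  forall nu, unit_normal a i p nu ->
    exists lambda : R,
      second_fundamental_form a i p nu = lambda *: induced_form a i p.

Definition photon_surface : Prop :=
  [/\ hypersurface, timelike & totally_umbilic].

Definition constant_along (F : M -> R) : Prop := exists c, forall p, F (f p) = c.

Definition differential_norm_constant_along (F : M -> R) : Prop :=
  exists c, forall i p, chart_dom i (f p) -> differential_norm g F i (f p) = c.

Definition differential_nonzero_along (F : M -> R) : Prop :=
  forall i p, chart_dom i (f p) -> differential F i (f p) != 0.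

End Maps.
End Geometry.

Section Product.
Variables (R : realType) (n : nat) (M : manifold R n).

Definition line_dom (i : chart_index M) : set (R * M) := [set q | chart_dom i q.2].
Definition line_chart (i : chart_index M) (q : R * M) : 'rV[R]_(1 + n) :=
  row_mx q.1%:M (chart i q.2).
Definition line_chart_inv (i : chart_index M) (x : 'rV[R]_(1 + n)) : R * M :=
  (lsubmx x 0 0, chart_inv i (rsubmx x)).

Lemma line_image i (U : set M) :
  line_chart i @` [set q | U q.2] = [set x | (chart i @` U) (rsubmx x)].
Proof.
apply/seteqP; split=> [_ [q Uq <-]|x [p Up px]] /=.
  by rewrite /line_chart row_mxKr; exists q.2.
exists (lsubmx x 0 0, p) => //=.
by rewrite /line_chart /= -mx11_scalar px hsubmxK.
Qed.

Lemma line_open_dom i : open (line_dom i).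
Proof.
apply: (@open_comp _ _ (snd : R * M -> M)); last exact: open_chart_dom.
by move=> q _; exact: cvg_snd.
Qed.

Lemma line_open_image i : open (line_chart i @` line_dom i).
Proof.
rewrite line_image; apply: (@open_comp _ _ (@rsubmx R 1 1 n)).
  by move=> x _; exact: rsubmx_continuous.
exact: open_chart_image.
Qed.

Lemma line_cover q : exists i, line_dom i q.
Proof. exact: chart_cover. Qed.

Lemma line_chartK i q : line_dom i q -> line_chart_inv i (line_chart i q) = q.
Proof.
case: q => t p ip; rewrite /line_chart_inv /line_chart row_mxKl row_mxKr.
by rewrite mxE eqxx chartK.
Qed.

Lemma line_chart_continuous i q :
  line_dom i q -> {for q, continuous (line_chart i)}.
Proof.
move=> iq; apply: mx_continuous => r c; rewrite (ord1 r) {r}.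
case: (split_ordP c) => {}c ->.
  have -> : (fun q' => line_chart i q' 0 (lshift n c)) = fst.
    by apply/funext => q'; rewrite /line_chart row_mxEl (ord1 c) mxE eqxx.
  exact: cvg_fst.
have -> : (fun q' => line_chart i q' 0 (rshift 1 c)) =
          (fun x : 'rV[R]_n => x 0 c) \o (chart i \o snd).
  by apply/funext => q'; rewrite /line_chart row_mxEr.
apply: (@continuous_comp _ _ _ (chart i \o snd)); last exact: coord_continuous.
by apply: (@continuous_comp _ _ _ snd); [exact: cvg_snd|exact: chart_continuous].
Qed.

Lemma line_chart_inv_continuous i q : line_dom i q ->
  {for line_chart i q, continuous (line_chart_inv i)}.
Proof.
move=> iq.
have ct : {for line_chart i q, continuous (fun x => lsubmx x 0 0)}.
  exact: time_continuous.
have cp : {for line_chart i q, continuous (chart_inv i \o @rsubmx R 1 1 n)}.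
  apply: (@continuous_comp _ _ _ (@rsubmx R 1 1 n) (chart_inv i)).
    exact: rsubmx_continuous.
  by rewrite /line_chart row_mxKr; exact: chart_inv_continuous.
exact: (cvg_pair ct cp).
Qed.

Lemma line_transitionE i j :
  line_chart j \o line_chart_inv i =
  fun x => row_mx (lsubmx x) (transition i j (rsubmx x)).
Proof. by apply/funext => x; rewrite /line_chart /= -mx11_scalar. Qed.

Lemma line_transition_smooth i j :
  smooth_mx (line_chart i @` (line_dom i `&` line_dom j))
            (line_chart j \o line_chart_inv i).
Proof.
rewrite line_transitionE.
have -> : line_dom i `&` line_dom j =
  [set q : R * M | (chart_dom i `&` chart_dom j) q.2] by [].
rewrite line_image => r c k.
case: (split_ordP c) => {}c ->.
  rewrite [X in Ck _ _ X](_ : _ = fun x => lsubmx x 0 0); first exact: Ck_time.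
  by apply/funext => x; rewrite row_mxEl !ord1.
rewrite [X in Ck _ _ X](_ : _ =
    fun x : 'rV[R]_(1 + n) => transition i j (rsubmx x) r c).
  by apply: (@Ck_lift _ _ _ _ (fun y => transition i j y r c));
    exact: transition_smooth.
by apply/funext => x; rewrite row_mxEr.
Qed.

Lemma line_hausdorff : hausdorff_space (R * M)%type.
Proof.
move=> [t p] [s q] tsq.
have -> : t = s.
  apply: Rhausdorff => A B tA sB.
  have [] := tsq (A `*` setT) (B `*` setT).
  - by exists (A, setT) => //; split => //; exact: filterT.
  - by exists (B, setT) => //; split => //; exact: filterT.
  by move=> [u v] [[Au _] [Bu _]]; exists u.
have -> // : p = q.
apply: (@manifold_hausdorff _ _ M) => A B pA qB.
have [] := tsq (setT `*` A) (setT `*` B).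
- by exists (setT, A) => //; split => //; exact: filterT.
- by exists (setT, B) => //; split => //; exact: filterT.
by move=> [u v] [[_ Av] [_ Bv]]; exists v.
Qed.

Lemma real_second_countable : @second_countable R.
Proof.
pose I (ab : rat * rat) : set R := [set` `]ratr ab.1, ratr ab.2[].
exists (range I); first exact: (card_le_trans (card_image_le _ _) (countableP _)).
split=> [_ [ab _ <-]|x A /nbhs_ballP[e /= e0 eA]]; first exact: interval_open.
have /rat_in_itvoo[a] : x - e < x by rewrite ltrBlDr ltrDl.
have /rat_in_itvoo[b] : x < x + e by rewrite ltrDl.
rewrite !in_itv /= => /andP[xb be] /andP[ea ax].
exists (I (a, b)); first by split; [exists (a, b)|rewrite /I /= in_itv /= ax].
rewrite /I => y /=; rewrite in_itv /= => /andP[ay yb]; apply: eA => /=.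
by rewrite /ball /= ltr_distlC (lt_trans ea ay) (lt_trans yb be).
Qed.

Lemma line_second_countable : @second_countable (R * M)%type.
Proof.
have [B cB [oB bB]] := real_second_countable.
have [C cC [oC bC]] := manifold_second_countable M.
exists [set D.1 `*` D.2 | D in B `*` C].
  exact: (card_le_trans (card_image_le _ _) (countableX cB cC)).
split=> [_ [[U V] [/= /oB oU /oC oV] <-]|[t p] A [[U V] /= [tU pV] UVA]].
  apply: openI.
    by apply: (@open_comp _ _ fst) => // q _; exact: cvg_fst.
  by apply: (@open_comp _ _ snd) => // q _; exact: cvg_snd.
have [U' [BU' U't] sU] := bB t U tU.
have [V' [CV' V'p] sV] := bC p V pV.
exists (U' `*` V'); first by split; [exists (U', V')|].
by move=> [u v] [/= /sU Uu /sV Vv]; exact: UVA.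
Qed.

(* R x M with the charts (t, p) |-> (t, chart i p). *)
Definition line_product : manifold R n.+1 :=
  @Manifold R (1 + n) (R * M)%type (chart_index M) line_dom line_chart
    line_chart_inv line_open_dom line_open_image line_cover line_chartK
    line_chart_continuous line_chart_inv_continuous line_transition_smooth
    line_hausdorff line_second_countable.

End Product.

Section StaticMetric.
Variables (R : realType) (n : nat) (M : manifold R n) (g : metric M) (N : M -> R).
Hypothesis N_smooth : smooth_scalar N.
Hypothesis N_gt0 : forall p, 0 < N p.

Definition static_gram (i : chart_index M) (q : R * M) : 'M[R]_(1 + n) :=
  block_mx (- N q.2 ^+ 2)%:M 0 0 (g i q.2).

Lemma static_gram_smooth i :
  smooth_mx (line_chart i @` line_dom i) (static_gram i \o line_chart_inv i).
Proof.
rewrite line_image => r c k.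
case: (split_ordP r) => {}r ->; case: (split_ordP c) => {}c ->.
- pose f y := -1 * ((N \o chart_inv i) y * (N \o chart_inv i) y) : R.
  have -> : (fun x => (static_gram i \o line_chart_inv i) x
               (lshift n r) (lshift n c)) = fun x => f (rsubmx x).
    apply/funext => x.
    by rewrite /static_gram /= block_mxEul mxE !ord1 eqxx /f mulN1r -expr2.
  apply: (@Ck_lift _ _ _ _ f).
  apply: CkM; [exact: open_chart_image|exact: Ck_cst|].
  by apply: CkM; [exact: open_chart_image|exact: N_smooth|exact: N_smooth].
- have -> : (fun x => (static_gram i \o line_chart_inv i) x
               (lshift n r) (rshift 1 c)) = fun=> 0.
    by apply/funext => x; rewrite /static_gram /= block_mxEur mxE.
  exact: Ck_cst.
- have -> : (fun x => (static_gram i \o line_chart_inv i) x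
               (rshift 1 r) (lshift n c)) = fun=> 0.
    by apply/funext => x; rewrite /static_gram /= block_mxEdl mxE.
  exact: Ck_cst.
- pose f y := (g i \o chart_inv i) y r c.
  have -> : (fun x => (static_gram i \o line_chart_inv i) x
               (rshift 1 r) (rshift 1 c)) = fun x => f (rsubmx x).
    by apply/funext => x; rewrite /static_gram /= block_mxEdr.
  by apply: (@Ck_lift _ _ _ _ f); exact: gram_smooth.
Qed.

Lemma static_gram_sym i q : line_dom i q -> (static_gram i q)^T = static_gram i q.
Proof.
by move=> iq; rewrite tr_block_mx tr_scalar_mx !trmx0 (gram_sym g iq).
Qed.

Lemma static_gram_unit i q : line_dom i q -> static_gram i q \in unitmx.
Proof.
move=> iq; have gu := gram_unit g iq; rewrite unitmxE in gu.
rewrite unitmxE det_ublock unitrM gu andbT.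
by rewrite det_scalar expr1 unitrN unitrX // unitfE gt_eqF.
Qed.

Lemma static_gram_transition i j q : line_dom i q -> line_dom j q ->
  static_gram i q =
  jac (line_chart j \o line_chart_inv i) (line_chart i q) *m static_gram j q *m
  (jac (line_chart j \o line_chart_inv i) (line_chart i q))^T.
Proof.
move=> iq jq; rewrite line_transitionE jac_lift /line_chart row_mxKr /static_gram.
rewrite tr_block_mx !mulmx_block !trmx0 trmx1 !mul1mx !mulmx0 !mul0mx.
by rewrite !addr0 !add0r !mulmx1 mul0mx -(gram_transition g iq jq).
Qed.

(* The metric - N^2 dt^2 + g on R x M. *)
Definition static_metric : metric (line_product M) :=
  @Metric R (1 + n) (line_product M) static_gram static_gram_smooth
    static_gram_sym static_gram_unit static_gram_transition.

Lemma static_gram_lorentzian : riemannian g ->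
  forall (i : chart_index M) (q : R * M), line_dom i q ->
    lorentzian_form (static_gram i q).
Proof.
move=> posg i q iq; exists (row_mx 1%:M 0).
  rewrite /static_gram mul_row_block tr_row_mx mul_row_col.
  rewrite !mul1mx !mul0mx !addr0.
  by rewrite mul0mx addr0 trmx1 mulmx1 mxE eqxx mulr1n oppr_lt0 exprn_gt0.
move=> w; rewrite -[w](@hsubmxK _ 1 1 n).
move: (lsubmx w) (rsubmx w) => t v w0.
rewrite /static_gram mul_row_block tr_row_mx mul_row_col.
rewrite !mul1mx !mul0mx !addr0 mul0mx addr0 mul_scalar_mx mxE [t^T _ _]mxE.
move=> /eqP; rewrite mulf_eq0 oppr_eq0 sqrf_eq0 gt_eqF //= => /eqP t0.
have tE : t = 0 by apply/matrixP => a b; rewrite !ord1 t0 mxE.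
rewrite mul_row_block mul_row_col tE !mul0mx !mulmx0 !add0r ?mul0mx ?add0r.
apply: posg iq _ _; apply: contra_neq w0 => ->.
by rewrite tE row_mx0.
Qed.

End StaticMetric.

Record electrostatic_spacetime (R : realType) (n : nat) := ElectrostaticSpacetime {
  slice : manifold R n;
  slice_metric : metric slice;
  lapse : slice -> R;
  potential : slice -> R;
  slice_riemannian : riemannian slice_metric;
  lapse_smooth : smooth_scalar lapse;
  lapse_gt0 : forall p, 0 < lapse p;
  potential_smooth : smooth_scalar potential }.

Arguments slice {R n} e.
Arguments slice_metric {R n} e.
Arguments lapse {R n} e _.
Arguments potential {R n} e _.

Section Electrostatic.
Variables (R : realType) (n : nat) (E : electrostatic_spacetime R n).

Definition spacetime : manifold R n.+1 := line_product (slice E).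

Definition spacetime_metric : metric spacetime :=
  static_metric (slice_metric E) (lapse_smooth (e:=E)) (lapse_gt0 (e:=E)).

Definition spacetime_lapse (q : spacetime) : R := lapse E q.2.
Definition spacetime_potential (q : spacetime) : R := potential E q.2.

Variables (k : nat) (S : manifold R k) (iota : S -> slice E).

(* R x S -> R x M; its domain carries the product manifold structure. *)
Definition cylinder (q : line_product S) : spacetime := (q.1, iota q.2).

Definition photon_sphere : Prop :=
  [/\ photon_surface cylinder spacetime_metric,
      constant_along cylinder spacetime_lapse,
      constant_along cylinder spacetime_potential &
      differential_norm_constant_along cylinder spacetime_metric
        spacetime_potential].

Definition nondegenerate_photon_sphere : Prop :=
  photon_sphere /\ differential_nonzero_along cylinder spacetime_lapse.

End Electrostatic.

(* Main.v *)
(* In the splitting R x M everything is block diagonal: the cylinder over S has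
   differential 1 + d iota and induced form -N^2 + (induced form of S), and its
   unit normals are the unit normals w of S.  The only new Christoffel symbol
   that pairs with w is Gamma_tt = N grad N, so the second fundamental form is
   block diagonal with time entry - N dN(w).  If S is umbilic with factor lambda,
   the cylinder is umbilic as soon as - N dN(w) = - lambda N^2, and since the mean
   curvature of S is (n - 1) lambda, this is the hypothesis N H = (n - 1) dN(nu). *)
Require Import Defs.
From mathcomp Require Import all_boot all_order all_algebra.
From mathcomp Require Import all_classical all_reals all_analysis.
Import Order.TTheory GRing.Theory Num.Theory.
Local Open Scope ring_scope.

Set Implicit Arguments.
Unset Strict Implicit.
Unset Printing Implicit Defensive.
Import numFieldNormedType.Exports.
Local Open Scope classical_set_scope.

(** * Linear algebra of block-diagonal matrices *)

Lemma invmx_block_diag (F : comUnitRingType) m n (A : 'M[F]_m) (B : 'M[F]_n) :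
  A \in unitmx -> B \in unitmx ->
  invmx (block_mx A 0 0 B) = block_mx (invmx A) 0 0 (invmx B).
Proof.
move=> uA uB; have uAB : block_mx A 0 0 B \in unitmx.
  by rewrite unitmxE det_ublock unitrM -!unitmxE uA.
rewrite -[RHS](mulKmx uAB) mulmx_block !mulmx0 !mul0mx !addr0 !add0r.
by rewrite !mulmxV // -scalar_mx_block mulmx1.
Qed.

Lemma row_free_block_diag (F : fieldType) m n p (A : 'M[F]_m) (B : 'M[F]_(n, p)) :
  row_free A -> row_free B -> row_free (block_mx A 0 0 B).
Proof.
rewrite -!kermx_eq0 => /eqP kA /eqP kB; rewrite kermx_eq0.
apply/inj_row_free => v; rewrite -[v]hsubmxK mul_row_block !mulmx0 addr0 add0r.
move=> /eqP; rewrite row_mx_eq0 => /andP[/eqP vA /eqP vB].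
move/eqP: vA; rewrite -sub_kermx kA submx0 => /eqP ->.
by move/eqP: vB; rewrite -sub_kermx kB submx0 => /eqP ->; rewrite row_mx0.
Qed.

(** The first basis vector is the negative direction. As [c] is nonzero, a vector orthogonal to it
    has zero first component, so only the positive block [A] contributes. *)
Lemma lorentzian_block_diag (R : realType) n (c : R) (A : 'M[R]_n) : c < 0 ->
  (forall v : 'rV[R]_n, v != 0 -> 0 < (v *m A *m v^T) 0 0) ->
  lorentzian_form (block_mx (c%:M : 'M[R]_1) 0 0 A).
Proof.
move=> c0 posA; exists (row_mx 1%:M 0).
  rewrite mul_row_block tr_row_mx mul_row_col !mul1mx !mul0mx !addr0.
  by rewrite mul0mx addr0 trmx1 mulmx1 mxE eqxx mulr1n.
move=> w; rewrite -[w](@hsubmxK _ 1 1 n).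
move: (lsubmx w) (rsubmx w) => t v w0.
rewrite mul_row_block tr_row_mx mul_row_col.
rewrite !mul1mx !mul0mx !addr0 mul0mx addr0 mul_scalar_mx mxE [t^T _ _]mxE.
move=> /eqP; rewrite mulf_eq0 lt_eqF //= => /eqP t0.
have tE : t = 0 by apply/matrixP => a b; rewrite !ord1 t0 mxE.
rewrite mul_row_block mul_row_col tE !mul0mx !mulmx0 !add0r ?mul0mx ?add0r.
by apply: posA; apply: contra_neq w0 => ->; rewrite tE row_mx0.
Qed.

(** * Induced form and unit normals of an immersion into a Riemannian manifold *)

Section Hypersurface.
Variables (R : realType) (k n : nat) (S : manifold R k) (M : manifold R n).
Variables (f : S -> M) (g : metric M).
Hypothesis g_riem : riemannian g.
Hypothesis f_imm : immersion f.

(** The differential of an immersion is injective, so the positivity of [g] pulls back. *)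
Lemma induced_form_gt0 a i p : chart_dom a p -> chart_dom i (f p) ->
  forall v : 'rV[R]_k, v != 0 -> 0 < (v *m induced_form f g a i p *m v^T) 0 0.
Proof.
move=> ap ip v v0; have /row_freeP[B JB] := f_imm.2 a i p ap ip.
have : v *m Defs.pushforward f a i p != 0.
  by apply: contra_neq v0 => vJ; rewrite -[v]mulmx1 -JB mulmxA vJ mul0mx.
by move/(g_riem ip); rewrite /inner trmx_mul /induced_form !mulmxA.
Qed.

(** A positive definite form has trivial kernel. This makes the inverse in the mean curvature
    genuine. *)
Lemma induced_form_unit a i p : chart_dom a p -> chart_dom i (f p) ->
  induced_form f g a i p \in unitmx.
Proof.
move=> ap ip; rewrite -row_free_unit; apply/inj_row_free => v vI.
apply/eqP/negPn/negP => /(induced_form_gt0 ap ip).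
by rewrite vI mul0mx mxE ltxx.
Qed.

(* The normal vectors form the left kernel of [g J^T], which has rank 1. *)
Lemma unit_normal_unique a i p nu w : n = k.+1 ->
  chart_dom a p -> chart_dom i (f p) ->
  unit_normal f g a i p nu -> unit_normal f g a i p w -> w = nu \/ w = - nu.
Proof.
move=> nk ap ip [nu_perp nu1] [w_perp w1].
have gu := gram_unit g ip; have gT := gram_sym g ip.
set J := Defs.pushforward f a i p in nu_perp w_perp.
pose K := kermx (g i (f p) *m J^T).
have inK u : (forall X, inner g i (f p) (X *m J) u = 0) -> (u <= K)%MS.
  move=> uJ; apply/sub_kermxP; apply: trmx_inj; rewrite !trmx_mul trmxK gT trmx0.
  apply/matrixP => b r; rewrite ord1 [RHS]mxE -[RHS](uJ (delta_mx 0 b)) /inner.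
  by rewrite -rowE -!row_mul [RHS]mxE.
have rK : \rank K = 1%N.
  rewrite mxrank_ker -mxrank_tr trmx_mul trmxK gT mxrankMfree ?row_free_unit //.
  by have /eqP -> := f_imm.2 a i p ap ip; rewrite nk subSnn.
have nu0 : nu != 0.
  apply/eqP => nu0; move: nu1; rewrite nu0 /inner trmx0 mulmx0 mxE normr0.
  by move=> /esym/eqP; rewrite oner_eq0.
have : (w <= nu)%MS.
  apply: submx_trans (inK _ w_perp) _.
  have := mxrank_leqif_sup (inK _ nu_perp).
  by rewrite rK rank_rV nu0 => -[_ <-].
(* Comparing the lengths of [w] and [nu] gives [c ^+ 2 = 1]. *)
move=> /sub_rVP[c wc]; move: w1.
rewrite wc /inner linearZ /= -scalemxAl -scalemxAr -scalemxAl scalerA mxE normrM.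
have -> : `|(nu *m g i (f p) *m nu^T) 0 0| = 1 by [].
move=> /eqP; rewrite mulr1 ger0_norm -expr2 ?sqr_ge0 // sqrf_eq1.
by case/orP => /eqP ->; [left; rewrite scale1r|right; rewrite scaleN1r].
Qed.

End Hypersurface.

(** Pointwise forms of [partial_lift0] and, below, [partial_liftr], for goals where the
    time-independent function is visible only up to conversion. *)
Lemma partial_lift0E (R : realType) n (f : 'rV[R]_n -> R) x :
  partial (lshift n 0) (fun x : 'rV[R]_(1 + n) => f (rsubmx x)) x = 0.
Proof. by rewrite partial_lift0. Qed.

Lemma partial_liftrE (R : realType) n (f : 'rV[R]_n -> R) j x :
  partial (rshift 1 j) (fun x : 'rV[R]_(1 + n) => f (rsubmx x)) x =
  partial j f (rsubmx x).
Proof. by rewrite partial_liftr. Qed.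

Lemma partial_cst (R : realType) n (c : R) (j : 'I_n) x :
  partial j (fun=> c) x = 0.
Proof. exact: derive_cst. Qed.

(** * Derivatives, inverse and Christoffel symbols of the static metric *)

Section StaticMetricGeometry.
Variables (R : realType) (n : nat) (M : manifold R n) (g : metric M) (N : M -> R).
Hypotheses (N_smooth : smooth_scalar N) (N_gt0 : forall p, 0 < N p).
Let G : metric (line_product M) := static_metric g N_smooth N_gt0.
Variables (i : chart_index M) (q : R * M).
Hypothesis iq : chart_dom i q.2.

Local Notation t0 := (lshift n (0 : 'I_1)).
Local Notation x_ j := (rshift 1 j).

Lemma lapse_derivable j :
  derivable (N \o chart_inv i) (chart i q.2) (delta_mx 0 j : 'rV[R]_n).
Proof. by have [_ /(_ j)[+ _]] := N_smooth i 1%N; apply; exists q.2. Qed.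

(* The indices below live in ['I_(1 + n)] while those of [G] live in the merely
   convertible ['I_n.+1]; rewriting at [LHS] or [RHS] bridges the two. *)
Lemma static_gram_tt : (fun x : 'rV[R]_(1 + n) =>
    G i (chart_inv (i : chart_index (line_product M)) x) t0 t0) =
  (fun x => (fun y => - (N (chart_inv i y)) ^+ 2) (rsubmx x)).
Proof.
by apply/funext => x; rewrite /G /= /static_gram [LHS]block_mxEul !mxE eqxx mulr1n.
Qed.

Lemma static_gram_tx j : (fun x : 'rV[R]_(1 + n) =>
    G i (chart_inv (i : chart_index (line_product M)) x) t0 (x_ j)) = (fun=> 0).
Proof. by apply/funext => x; rewrite /G /= /static_gram [LHS]block_mxEur !mxE. Qed.

Lemma static_gram_xt j : (fun x : 'rV[R]_(1 + n) =>
    G i (chart_inv (i : chart_index (line_product M)) x) (x_ j) t0) = (fun=> 0).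
Proof. by apply/funext => x; rewrite /G /= /static_gram [LHS]block_mxEdl !mxE. Qed.

Lemma static_gram_xx j l : (fun x : 'rV[R]_(1 + n) =>
    G i (chart_inv (i : chart_index (line_product M)) x) (x_ j) (x_ l)) =
  (fun x => (fun y => g i (chart_inv i y) j l) (rsubmx x)).
Proof. by apply/funext => x; rewrite /G /= /static_gram [LHS]block_mxEdr. Qed.

(** Staticity: each metric coefficient either vanishes or depends on the spatial coordinates
    alone. *)
Lemma partial_static_t (a b : 'I_(1 + n)) :
  partial_gram G (i : chart_index (line_product M)) q t0 a b = 0.
Proof.
rewrite /partial_gram; case: (split_ordP a) => {}a ->; case: (split_ordP b) => {}b ->.
- rewrite !ord1 static_gram_tt.
  exact: (partial_lift0E (fun y => - N (chart_inv i y) ^+ 2)).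
- by rewrite !ord1 static_gram_tx partial_cst.
- by rewrite !ord1 static_gram_xt partial_cst.
- rewrite static_gram_xx.
  exact: (partial_lift0E (fun y => g i (chart_inv i y) a b)).
Qed.

Lemma partial_static_tt a :
  partial_gram G (i : chart_index (line_product M)) q (x_ a) t0 t0 =
  - (2 * N q.2 * differential N i q.2 0 a).
Proof.
rewrite /partial_gram static_gram_tt.
rewrite [LHS](partial_liftrE (fun y => - (N (chart_inv i y)) ^+ 2)) /=.
rewrite /line_chart row_mxKr /partial.
have dN := @lapse_derivable a.
have -> : (fun y => - N (chart_inv i y) ^+ 2) =
    - ((N \o chart_inv i) * (N \o chart_inv i)).
  by apply/funext.
rewrite deriveN ?deriveM //; last exact: derivableM.
by rewrite mxE /= chartK // -mulr2n -mulrA mulr_natl.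
Qed.

Lemma partial_static_tx a b :
  partial_gram G (i : chart_index (line_product M)) q a t0 (x_ b) = 0.
Proof. by rewrite /partial_gram static_gram_tx partial_cst. Qed.

Lemma partial_static_xt a b :
  partial_gram G (i : chart_index (line_product M)) q a (x_ b) t0 = 0.
Proof. by rewrite /partial_gram static_gram_xt partial_cst. Qed.

Lemma partial_static_xx a b c :
  partial_gram G (i : chart_index (line_product M)) q (x_ a) (x_ b) (x_ c) =
  partial_gram g i q.2 a b c.
Proof.
rewrite /partial_gram static_gram_xx.
rewrite [LHS](partial_liftrE (fun y => g i (chart_inv i y) b c)) /=.
by rewrite /line_chart row_mxKr.
Qed.

Lemma invmx_static_gram :
  invmx (static_gram g N i q) =
  block_mx (- N q.2 ^+ 2)^-1%:M 0 0 (invmx (g i q.2)).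
Proof.
rewrite /static_gram invmx_block_diag ?invmx_scalar ?gram_unit //.
by rewrite unitmxE det_scalar expr1 unitrN unitrX // unitfE gt_eqF.
Qed.

Let Gam := christoffel G (i : chart_index (line_product M)) q.

(** The inverse metric is block diagonal, so raising to a spatial index only involves spatial
    [l]. *)
Lemma christoffel_static_x c a b : Gam (x_ c) a b =
  2^-1 * \sum_l invmx (g i q.2) c l *
    (partial_gram G (i : chart_index (line_product M)) q a b (x_ l) +
     partial_gram G (i : chart_index (line_product M)) q b a (x_ l)
     - partial_gram G (i : chart_index (line_product M)) q (x_ l) a b).
Proof.
rewrite /Gam /christoffel; congr (_ * _).
(* The same sum, retyped over ['I_(1 + n)] so that it splits into time and space. *)
transitivity (\sum_(l < 1 + n) invmx (static_gram g N i q) (x_ c) l *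
  (partial_gram G (i : chart_index (line_product M)) q a b l +
   partial_gram G (i : chart_index (line_product M)) q b a l
   - partial_gram G (i : chart_index (line_product M)) q l a b)) => //.
rewrite invmx_static_gram big_split_ord /=.
rewrite big_ord1 block_mxEdl mxE mul0r add0r.
by apply: eq_bigr => l _; rewrite block_mxEdr.
Qed.

Lemma christoffel_static_xx c a b :
  Gam (x_ c) (x_ a) (x_ b) = christoffel g i q.2 c a b.
Proof.
rewrite christoffel_static_x; congr (_ * _); apply: eq_bigr => l _.
by rewrite !partial_static_xx.
Qed.

(** In the mixed symbols each term is a time derivative or differentiates a vanishing off-diagonal
    coefficient. *)
Lemma christoffel_static_tx c a : Gam (x_ c) t0 (x_ a) = 0.
Proof.
rewrite christoffel_static_x big1 ?mulr0 // => l _.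
by rewrite partial_static_t !partial_static_tx addr0 subr0 mulr0.
Qed.

Lemma christoffel_static_xt c a : Gam (x_ c) (x_ a) t0 = 0.
Proof.
rewrite christoffel_static_x big1 ?mulr0 // => l _.
by rewrite partial_static_t partial_static_tx partial_static_xt addr0 subr0 mulr0.
Qed.

(** Of the three derivatives only that of the coefficient $-N^2$ in a spatial direction survives;
    its factor 2 cancels the one half. *)
Lemma christoffel_static_tt c :
  Gam (x_ c) t0 t0 = N q.2 * (differential N i q.2 *m invmx (g i q.2)) 0 c.
Proof.
rewrite christoffel_static_x !mxE !big_distrr /=; apply: eq_bigr => l _.
rewrite !partial_static_t partial_static_tt add0r sub0r opprK.
(* Symmetry of the inverse metric lets the row vector of $dN$ be contracted from the left. *)
have -> : invmx (g i q.2) c l = invmx (g i q.2) l c.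
  by rewrite -[in RHS](gram_sym g iq) -trmx_inv mxE.
rewrite !mulrA [2^-1 * _]mulrC -!mulrA (mulrA 2^-1) mulVf ?mul1r ?pnatr_eq0 //.
by rewrite mulrCA; congr (_ * _); rewrite mulrC.
Qed.

End StaticMetricGeometry.

(** A time-independent function has no $dt$ component. This serves both the norm of $d\Psi$ and the
    non-vanishing of $dN$. *)
Lemma differential_lift (R : realType) n (M : manifold R n) (F : M -> R)
    (i : chart_index M) (q : R * M) :
  differential (M := line_product M) (fun q => F q.2) i q =
  (row_mx 0 (differential F i q.2) : 'rV[R]_(1 + n)).
Proof.
apply/rowP => j; rewrite [LHS]mxE.
case: (@split_ordP 1 n j) => {}j ->.
  rewrite [RHS]row_mxEl mxE (ord1 j).
  exact: (partial_lift0E (F \o chart_inv i)).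
rewrite [RHS]row_mxEr mxE.
apply: etrans (partial_liftrE (F \o chart_inv i) _ _) _.
by rewrite /= /line_chart row_mxKr.
Qed.

(** * The cylinder as an embedded timelike hypersurface, and its unit normals *)

Section Cylinder.
Variables (R : realType) (n : nat) (E : electrostatic_spacetime R n).
Variables (k : nat) (S : manifold R k) (iota : S -> slice E).

Let g := slice_metric E.
Let N := lapse E.
Let G := spacetime_metric E.
Let C := cylinder iota.

Lemma cylinder_local_expr (a : chart_index S) (i : chart_index (slice E)) :
  local_expr C a i =
  fun x : 'rV[R]_(1 + k) => row_mx (lsubmx x) (local_expr iota a i (rsubmx x))
    : 'rV[R]_(1 + n).
Proof.
by apply/funext => x; rewrite /local_expr /= /line_chart /= -mx11_scalar.
Qed.

Lemma jac_cylinder (a : chart_index S) (i : chart_index (slice E))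
    (x : 'rV[R]_(1 + k)) :
  jac (local_expr C a i) x =
  block_mx 1%:M 0 0 (jac (local_expr iota a i) (rsubmx x))
    :> 'M[R]_(1 + k, 1 + n).
Proof. by rewrite cylinder_local_expr [LHS]jac_lift. Qed.

Lemma pushforward_cylinder (a : chart_index S) (i : chart_index (slice E)) q :
  Defs.pushforward C a i q =
  block_mx 1%:M 0 0 (Defs.pushforward iota a i q.2) :> 'M[R]_(1 + k, 1 + n).
Proof. by rewrite /Defs.pushforward jac_cylinder /= /line_chart row_mxKr. Qed.

Lemma cylinder_smooth : smooth_map iota -> smooth_map C.
Proof.
move=> [ci si]; split.
  move=> q.
  suff cs : {for q, continuous (iota \o snd)}
    by exact: (cvg_pair (@cvg_fst _ _ _ _ _) cs).
  by apply: (@continuous_comp _ _ _ snd); [exact: cvg_snd|exact: ci].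
move=> a i; rewrite cylinder_local_expr.
have -> : chart_dom a `&` C @^-1` chart_dom i =
  [set q : R * S | (@chart_dom _ _ S a `&`
                    iota @^-1` @chart_dom _ _ (slice E) i) q.2] by [].
rewrite [X in smooth_mx X]line_image => r c m.
case: (@split_ordP 1 n c) => {}c ->.
  rewrite [X in Ck _ _ X](_ : _ = fun x : 'rV[R]_(1 + k) => lsubmx x 0 0).
    exact: Ck_time.
  by apply/funext => x; rewrite [LHS]row_mxEl !ord1.
rewrite [X in Ck _ _ X](_ : _ =
    fun x : 'rV[R]_(1 + k) => local_expr iota a i (rsubmx x) r c).
  by apply: (@Ck_lift _ _ _ _ (fun y => local_expr iota a i y r c)); exact: si.
by apply/funext => x; rewrite [LHS]row_mxEr.
Qed.

Lemma cylinder_immersion : immersion iota -> immersion C.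
Proof.
move=> [si fi]; split=> [|a i q aq iq]; first exact: cylinder_smooth.
rewrite pushforward_cylinder; apply: (@row_free_block_diag _ 1 k n).
  by rewrite row_free_unit unitmx1.
exact: fi.
Qed.

Lemma cylinder_embedding : smooth_embedding iota -> smooth_embedding C.
Proof.
move=> [ii inj emb]; split; first exact: cylinder_immersion.
  by move=> [t p] [s r] [-> /inj ->].
move=> U oU.
(* [V] is the union of the open boxes whose preimage under the cylinder map lies in [U]. *)
pose V : set (R * slice E) := [set q | exists A B,
  [/\ open A, open B, A q.1, B q.2 & A `*` (iota @^-1` B) `<=` U]].
exists V.
  rewrite openE => q [A [B [oA oB Aq Bq ABU]]].
  exists (A, B); first by split; apply: open_nbhs_nbhs.
  by move=> [t p] [/= At Bp]; exists A, B.
apply/seteqP; split=> [[t p] Utp|[t p] [A [B [_ _ At Bp ABU]]]]; last exact: ABU.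
have : nbhs (t, p) U by apply: open_nbhs_nbhs.
move=> [[A B] [/= tA pB] ABU].
(* A box around [(t, p)] inside [U] has its second side in [S]; the embedding of [S] turns the
   interior of that side into the preimage of an open set of the slice. *)
have [B' oB' B'E] := emb _ (open_interior B).
exists (interior A), B'; split => //.
- exact: open_interior.
- have : interior B p by [].
  by rewrite B'E.
by rewrite -B'E => -[s r] [/= /interior_subset As /interior_subset Br]; apply: ABU.
Qed.

Lemma induced_form_cylinder (a : chart_index S) (i : chart_index (slice E)) q :
  induced_form C G a i q =
  block_mx (- N (iota q.2) ^+ 2)%:M 0 0 (induced_form iota g a i q.2)
    :> 'M[R]_(1 + k).
Proof.
rewrite /induced_form pushforward_cylinder /=.
apply: etrans (_ : block_mx 1%:M 0 0 (Defs.pushforward iota a i q.2) *m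
  static_gram g N i (C q) *m
  (block_mx 1%:M 0 0 (Defs.pushforward iota a i q.2))^T = _) => //.
rewrite /static_gram tr_block_mx !mulmx_block !trmx0 trmx1 !mul1mx !mulmx0 !mul0mx.
by rewrite !addr0 !add0r !mulmx1 mul0mx.
Qed.

Lemma cylinder_timelike : immersion iota -> timelike C G.
Proof.
move=> ii a i q aq iq; rewrite induced_form_cylinder.
apply: (@lorentzian_block_diag _ k); first by rewrite oppr_lt0 exprn_gt0 // lapse_gt0.
exact: (induced_form_gt0 (@slice_riemannian _ _ E) ii).
Qed.

Lemma inner_spacetime (i : chart_index (slice E)) q (u v : 'rV[R]_1) (x y : 'rV[R]_n) :
  inner G i q (row_mx u x) (row_mx v y) =
  - N q.2 ^+ 2 * u 0 0 * v 0 0 + inner g i q.2 x y.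
Proof.
rewrite /inner /=.
apply: etrans (_ : (row_mx u x *m static_gram g N i q *m (row_mx v y)^T) 0 0 = _) => //.
rewrite /static_gram mul_row_block tr_row_mx mul_row_col !mulmx0 addr0 add0r.
rewrite mxE; congr (_ + _); rewrite mxE big_ord1 [v^T _ _]mxE; congr (_ * _).
by rewrite mul_mx_scalar mxE.
Qed.

(** The time direction is tangent to the cylinder and $N^2 > 0$, so a normal has no time component.
    Testing it against spatial tangent vectors then gives normality to [S]. *)
Lemma unit_normal_cylinder (a : chart_index S) (i : chart_index (slice E)) q nu :
  chart_dom a q.2 -> chart_dom i (iota q.2) ->
  unit_normal C G a i q nu ->
  exists2 w : 'rV[R]_n, nu = row_mx 0 w :> 'rV[R]_(1 + n) &
    unit_normal iota g a i q.2 w.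
Proof.
move=> aq iq; rewrite -[nu](@hsubmxK _ 1 1 n).
move: (@lsubmx _ 1 1 n nu) (@rsubmx _ 1 1 n nu) => u w [nu_perp nu1].
have u0 : u = 0.
  apply/rowP => j; rewrite ord1 mxE; apply/eqP.
  have := nu_perp (row_mx 1%:M 0 : 'rV[R]_(1 + k)).
  rewrite pushforward_cylinder.
  have -> : (row_mx 1%:M 0 : 'rV[R]_(1 + k)) *m
    block_mx 1%:M 0 0 (Defs.pushforward iota a i q.2) = row_mx 1%:M 0.
    by rewrite mul_row_block !mul1mx !mul0mx !addr0.
  rewrite inner_spacetime /inner !mul0mx !mxE addr0 mulr1 => /eqP.
  by rewrite mulf_eq0 oppr_eq0 sqrf_eq0 gt_eqF // lapse_gt0.
rewrite u0 in nu_perp nu1 *; exists w => //; split=> [X|].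
  have := nu_perp (row_mx 0 X : 'rV[R]_(1 + k)).
  rewrite pushforward_cylinder.
  have -> : (row_mx 0 X : 'rV[R]_(1 + k)) *m
    block_mx 1%:M 0 0 (Defs.pushforward iota a i q.2) =
    row_mx 0 (X *m Defs.pushforward iota a i q.2).
    by rewrite mul_row_block !mul0mx !mulmx0 !add0r.
  by rewrite inner_spacetime !mxE mulr0 add0r.
by move: nu1; rewrite inner_spacetime !mxE mulr0 add0r.
Qed.

(** * Second fundamental form of the cylinder *)

Section SecondFundamentalForm.
Variables (a : chart_index S) (i : chart_index (slice E)) (q : R * S).
Hypotheses (aq : chart_dom a q.2) (iq : chart_dom i (iota q.2)).

Let J (u : 'rV[R]_k) : 'M[R]_(k, n) := jac (local_expr iota a i) u.
Let B (x : 'rV[R]_(1 + k)) : 'M[R]_(1 + k, 1 + n) := block_mx 1%:M 0 0 (J (rsubmx x)).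
Let cd (b c : 'I_(1 + k)) : 'rV[R]_(1 + n) :=
  covariant_derivative C G a i q (delta_mx 0 b)
    (fun u => row c (jac (local_expr C a i) u)).
Local Notation x0 := (line_chart a q).

(** Only spatial components are computed, since a normal of the cylinder is spatial and the metric
    block diagonal. The double Christoffel sum splits into four blocks, of which the two mixed ones
    vanish. *)
Lemma covariant_derivative_cylinder b c m :
  cd b c 0 (rshift 1 m) =
  'D_(delta_mx 0 b : 'rV[R]_(1 + k)) (fun u => B u c (rshift 1 m)) x0 +
  (B x0 b (lshift n 0) * B x0 c (lshift n 0) *
     (N (iota q.2) * (differential N i (iota q.2) *m invmx (g i (iota q.2))) 0 m) +
   \sum_d \sum_e christoffel g i (iota q.2) m d e *
     B x0 b (rshift 1 d) * B x0 c (rshift 1 e)).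
Proof.
rewrite /cd [LHS]mxE; congr (_ + _).
  congr ('D_ _ _ _); apply/funext => u.
  by rewrite [LHS]mxE jac_cylinder.
transitivity (\sum_(d < 1 + n) \sum_(e < 1 + n)
    christoffel G i (C q) (rshift 1 m) d e * B x0 b d * B x0 c e).
  apply: eq_bigr => d _; apply: eq_bigr => e _.
  congr (_ * _ * _).
    by rewrite -rowE [LHS]mxE /Defs.pushforward jac_cylinder.
  by rewrite [LHS]mxE jac_cylinder.
have iCq : chart_dom (i : chart_index (slice E)) (C q).2 by [].
rewrite big_split_ord /= big_ord1 big_split_ord /= big_ord1.
rewrite christoffel_static_tt // [X in _ + X + _]big1 ?addr0; last first.
  by move=> e _; rewrite christoffel_static_tx // !mul0r.
congr (_ + _); first by rewrite [RHS]mulrC mulrA.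
apply: eq_bigr => d _; rewrite big_split_ord /= big_ord1.
rewrite christoffel_static_xt // !mul0r add0r.
by apply: eq_bigr => e _; rewrite christoffel_static_xx.
Qed.

Lemma second_fundamental_form_cylinder (w : 'rV[R]_n) :
  second_fundamental_form C G a i q (row_mx 0 w : 'rV[R]_(1 + n)) =
  block_mx (- (N (iota q.2) * directional_derivative N i (iota q.2) w))%:M 0 0
    (second_fundamental_form iota g a i q.2 w) :> 'M[R]_(1 + k).
Proof.
have Bxt u j : B u (rshift 1 j) (lshift n 0) = 0 by rewrite /B block_mxEdl mxE.
have Btx u j : B u (lshift k 0) (rshift 1 j) = 0 by rewrite /B block_mxEur mxE.
apply/matrixP => b c; rewrite [LHS]mxE.
have -> : inner G i (C q) (cd b c) (row_mx 0 w : 'rV[R]_(1 + n)) =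
    inner g i (iota q.2) (rsubmx (cd b c)) w.
  by rewrite -{1}[cd b c]hsubmxK inner_spacetime !mxE mulr0 add0r.
case: (@split_ordP 1 k b) => {}b ->; case: (@split_ordP 1 k c) => {}c ->.
- rewrite !ord1 [RHS]block_mxEul mxE eqxx mulr1n; congr (- _).
  have -> : rsubmx (cd (lshift k 0) (lshift k 0)) =
      N (iota q.2) *: (differential N i (iota q.2) *m invmx (g i (iota q.2))).
    apply/rowP => m; rewrite mxE covariant_derivative_cylinder.
    under [X in 'D_ _ X _]funext do rewrite Btx.
    rewrite derive_cst add0r !block_mxEul !mxE eqxx !mul1r.
    rewrite [X in _ + X]big1 ?addr0 //.
    by move=> d _; rewrite big1 // => e _; rewrite Btx mulr0 mul0r.
  (* The metric in the inner product cancels the inverse metric in the gradient, leaving $dN(w)$. *)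
  rewrite /inner -!scalemxAl mxE mulmxKV ?gram_unit //; congr (_ * _).
  by rewrite /directional_derivative -[in RHS](trmxK w) -trmx_mul [RHS]mxE.
- rewrite !ord1 [RHS]block_mxEur mxE.
  have -> : rsubmx (cd (lshift k 0) (rshift 1 c)) = 0.
    apply/rowP => m; rewrite mxE covariant_derivative_cylinder.
    under [X in 'D_ _ X _]funext do rewrite block_mxEdr.
    (* The Jacobian of [iota] does not depend on time, so its time derivative is zero. *)
    rewrite (derive_lift (fun y => J y c m)) rsubmx_delta0 derive0 add0r.
    rewrite Bxt mulr0 mul0r add0r [RHS]mxE big1 // => d _.
    by rewrite big1 // => e _; rewrite Btx mulr0 mul0r.
  by rewrite /inner !mul0mx mxE oppr0.
- rewrite !ord1 [RHS]block_mxEdl mxE.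
  have -> : rsubmx (cd (rshift 1 b) (lshift k 0)) = 0.
    apply/rowP => m; rewrite mxE covariant_derivative_cylinder.
    under [X in 'D_ _ X _]funext do rewrite Btx.
    rewrite derive_cst add0r.
    rewrite Bxt !mul0r add0r [RHS]mxE big1 // => d _.
    by rewrite big1 // => e _; rewrite Btx mulr0.
  by rewrite /inner !mul0mx mxE oppr0.
(* In the space-space block the terms are those of [iota] itself, evaluated at the spatial part of
   the chart point. *)
rewrite [RHS]block_mxEdr [RHS]mxE; congr (- inner _ _ _ _ _).
apply/rowP => m; rewrite mxE covariant_derivative_cylinder [RHS]mxE.
under [X in 'D_ _ X _]funext do rewrite block_mxEdr.
rewrite (derive_lift (fun y => J y c m)) rsubmx_deltar /line_chart row_mxKr.
rewrite Bxt !mul0r add0r; congr (_ + _).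
  by under [in RHS]eq_fun do rewrite mxE.
apply: eq_bigr => d _; apply: eq_bigr => e _.
by rewrite !block_mxEdr row_mxKr -rowE !mxE.
Qed.

End SecondFundamentalForm.

(** * Norm of the differential, mean curvature and umbilicity *)

Lemma spacetime_differential_norm (F : slice E -> R) (i : chart_index (slice E))
    (q : R * slice E) : chart_dom i q.2 ->
  differential_norm G (fun q => F q.2) i q = differential_norm g F i q.2.
Proof.
move=> iq; rewrite /differential_norm differential_lift.
congr (Num.sqrt `|_|).
transitivity ((row_mx 0 (differential F i q.2) *m invmx (static_gram g N i q) *m
  (row_mx 0 (differential F i q.2))^T) 0 0) => //.
rewrite invmx_static_gram //; last exact: lapse_gt0.
by rewrite mul_row_block tr_row_mx mul_row_col !mul0mx !mulmx0 !add0r mul0mx add0r.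
Qed.

Lemma second_fundamental_formN a i p w :
  second_fundamental_form iota g a i p (- w) =
  - second_fundamental_form iota g a i p w.
Proof. by apply/matrixP => b c; rewrite !mxE /inner linearN mulmxN !mxE. Qed.

(** The induced form cancels against its inverse, leaving [lambda] times the trace of the identity
    of size [k]. *)
Lemma mean_curvature_umbilic a i p nu lambda : immersion iota ->
  chart_dom a p -> chart_dom i (iota p) ->
  second_fundamental_form iota g a i p nu = lambda *: induced_form iota g a i p ->
  mean_curvature iota g a i p nu = lambda * k%:R.
Proof.
move=> ii ap ip e.
rewrite /mean_curvature e -scalemxAr mxtraceZ mulVmx ?mxtrace1 //.
exact: (induced_form_unit (@slice_riemannian _ _ E) ii).
Qed.

Lemma cylinder_umbilic (nu : chart_index (slice E) -> S -> 'rV[R]_n) :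
  n = k.+1 -> (0 < k)%N -> immersion iota ->
  (forall a i p, chart_dom a p -> chart_dom i (iota p) ->
     unit_normal iota g a i p (nu i p)) ->
  totally_umbilic iota g ->
  (forall a i p, chart_dom a p -> chart_dom i (iota p) ->
     N (iota p) * mean_curvature iota g a i p (nu i p) =
     k%:R * directional_derivative N i (iota p) (nu i p)) ->
  totally_umbilic C G.
Proof.
move=> nk k0 ii nuP umb NH a i q aq iq mu.
move=> /(unit_normal_cylinder aq iq)[w -> w_normal].
have [lambda lambdaE] := umb a i q.2 aq iq _ w_normal.
(* The spatial blocks are already proportional with factor [lambda]; this equation is what the time
   entries $-N\,dN(w)$ and $-N^2$ still require. *)
suff dNw : directional_derivative N i (iota q.2) w = N (iota q.2) * lambda.
  exists lambda; rewrite second_fundamental_form_cylinder // induced_form_cylinder.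
  transitivity (lambda *: (block_mx (- N (iota q.2) ^+ 2)%:M 0 0
    (induced_form iota g a i q.2) : 'M[R]_(1 + k))) => //.
  rewrite scale_block_mx !scaler0 lambdaE scale_scalar_mx dNw.
  by rewrite mulrN mulrA -expr2 [lambda * _]mulrC.
have kR : k%:R != 0 :> R by rewrite pnatr_eq0 -lt0n.
have nuP' := nuP a i q.2 aq iq.
(* With umbilic factor [l] along [nu] the hypothesis reads $N l k = k\,dN(\nu)$, and the nonzero [k]
   cancels. *)
have dN0 l : second_fundamental_form iota g a i q.2 (nu i q.2) =
      l *: induced_form iota g a i q.2 ->
    directional_derivative N i (iota q.2) (nu i q.2) = N (iota q.2) * l.
  move=> /(mean_curvature_umbilic ii aq iq) HE.
  by apply: (mulfI kR); rewrite -(NH _ _ _ aq iq) HE mulrA mulrC.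
(* Umbilicity concerns every unit normal, the curvature equation only [nu]. The two agree up to
   sign, and $dN(w)$ and the umbilic factor are both odd in the normal. *)
have := unit_normal_unique ii nk aq iq nuP' w_normal.
case=> wE; first by rewrite wE; apply: dN0; rewrite -wE.
rewrite wE /directional_derivative mulNmx mxE.
rewrite -[X in - X]/(directional_derivative N i (iota q.2) (nu i q.2)).
(* For [w = - nu] the factor along [nu] is [- lambda]. *)
rewrite (dN0 (- lambda)) ?mulrN ?opprK //.
by rewrite scaleNr -lambdaE wE second_fundamental_formN opprK.
Qed.

End Cylinder.

Theorem lemma5p9 (R : realType) (n : nat) (n_ge3 : (3 <= n)%N)
    (E : electrostatic_spacetime R n)
    (S : manifold R n.-1) (iota : S -> slice E)
    (nu : chart_index (slice E) -> S -> 'rV[R]_n)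
    (S_hypersurface : hypersurface iota)
    (nu_normal : unit_normal_field iota (slice_metric E) nu)
    (S_umbilic : totally_umbilic iota (slice_metric E))
    (N_constant : constant_along iota (lapse E))
    (Psi_constant : constant_along iota (potential E))
    (dPsi_constant :
       differential_norm_constant_along iota (slice_metric E) (potential E))
    (dN_nonzero : differential_nonzero_along iota (lapse E))
    (mean_curvature_eq :
       forall (a : chart_index S) (i : chart_index (slice E)) (p : S),
         chart_dom a p -> chart_dom i (iota p) ->
         lapse E (iota p) *
           mean_curvature iota (slice_metric E) a i p (nu i p) =
         n.-1%:R *
           directional_derivative (lapse E) i (iota p) (nu i p)) :
  nondegenerate_photon_sphere iota.
Proof.
have [nk emb] := S_hypersurface; have [ii _ _] := emb.
have k0 : (0 < n.-1)%N by rewrite -subn1 subn_gt0 (leq_trans _ n_ge3).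
split; first split.
- split; first by split; [rewrite -nk|exact: cylinder_embedding].
    exact: cylinder_timelike.
  by apply: cylinder_umbilic (nu_normal.2) _ _.
- by have [c cE] := N_constant; exists c => q; exact: cE.
- by have [c cE] := Psi_constant; exists c => q; exact: cE.
- have [c cE] := dPsi_constant; exists c => i q iq.
  by rewrite spacetime_differential_norm //; exact: cE.
move=> i q iq; rewrite differential_lift.
(* If the spacetime differential vanished, so would its spatial block, which is $dN$ on the
   slice. *)
apply: contra_neq (dN_nonzero i q.2 iq) => /(congr1 (@rsubmx R 1 1 n)).
by rewrite row_mxKr => ->; apply/rowP => j; rewrite !mxE.
Qed.
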